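(* Let $u:\mathbb R\to[-\infty,\infty)$ be an upper semicontinuous utility function satisfying $u(0)=-\infty$, and let $\mathcal R$ be a cash-convex risk functional on $L$ satisfying the lower Fatou property. Then $(\mathcal E_u,\mathcal R)$-terminal-wealth portfolio selection is market-independent well posed.
   Context: Setting. $(\Omega,\mathcal F,\mathbb P)$ is an atomless probability space. $L$ is a Riesz space of random variables (vector lattice for the $\mathbb P$-a.s. order) with $L^\infty\subset L\subset L^1$, which is law-invariant: if $Y\in L$ and $Z$ is a random variable on $(\Omega,\mathcal F,\mathbb P)$ with the same law as $Y$, then $Z\in L$. Constants are identified with constant random variables. A utility function is an increasing map $u:\mathbb R\to[-\infty,\infty)$ with $u(c)>-\infty$ for all $c>0$, $u(\infty):=\lim_{y\to\infty}u(y)>u(z)$ for all $z\in\mathbb R$, and $\limsup_{y\to\infty}u(y)/y<\infty$. The expected utility functional is $\mathcal E_u:L\to[-\infty,\infty)$, $\mathcal E_u(Y)=\mathbb E[u(Y)]$. A risk functional is a map $\mathcal R:L\to(-\infty,\infty]$ that is decreasing ($Y\le Z$ a.s. implies $\mathcal R(Y)\ge\mathcal R(Z)$) with $\mathcal R(c)\in\mathbb R$ for all constants $c>0$. Cash-convex: $\mathcal R(\lambda Y+(1-\lambda)c)\le\lambda\mathcal R(Y)+(1-\lambda)\mathcal R(c)$ for $\lambda\in(0,1)$, $Y\in L$, $c\in\mathbb R$. Lower Fatou property: $\mathcal R(Y)\le\liminf_n\mathcal R(Y_n)$ whenever $Y_n,Y\in L$, $Y_n\to Y$ a.s. and $|Y_n|\le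 Z$ a.s. for all $n$, for some $Z\in L$. Markets. $\mathbb S(L)$ is the set of all $\bar S=(S^0_t,\dots,S^d_t)_{t\in\{0,1\}}$, with arbitrary $d\in\mathbb N$, $S^i_0=1$ for all $i$, $S^0_1=1+r$ for some $r\in(-1,\infty)$, $S^i_1\in L$, that are arbitrage-free (there is no $\bar\theta\in\mathbb R^{1+d}$ with $\bar\theta\cdot\bar S_0\le0$, $\bar\theta\cdot\bar S_1\ge0$ a.s. and $\mathbb P[\bar\theta\cdot\bar S_1>0]>0$) and non-redundant ($S^0_1,\dots,S^d_1$ are linearly independent in $L$). Problem. For $\bar S\in\mathbb S(L)$, $w\in(0,\infty)$ and $R_{\max}\in[\mathcal R(w(1+r)),\infty)$, $(\mathcal E_u,\mathcal R)$-terminal-wealth portfolio selection is: maximize $\mathcal E_u(\bar\theta\cdot\bar S_1)$ over $\bar\theta\in\mathbb R^{1+d}$ with $\bar\theta\cdot\bar S_0=w$ and $\mathcal R(\bar\theta\cdot\bar S_1)\le R_{\max}$. It is well posed for $\bar S$ if for every such $w$ and $R_{\max}$ a maximizer exists, and market-independent well posed if it is well posed for every $\bar S\in\mathbb S(L)$. *)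

(* Defs.v *)
From HB Require Import structures.
From mathcomp Require Import all_boot all_order all_algebra.
From mathcomp Require Import all_classical all_reals all_analysis.

Set Implicit Arguments.
Unset Strict Implicit.
Unset Printing Implicit Defensive.

Import Order.TTheory GRing.Theory Num.Theory.
Import numFieldNormedType.Exports.

Local Open Scope classical_set_scope.
Local Open Scope ring_scope.

Section ProbabilitySpace.
Context {R : realType} {d : measure_display} {T : measurableType d}.
Variable P : probability T R.

Definition atom (A : set T) : Prop :=
  [/\ measurable A, (0 < P A)%E &
      forall B, measurable B -> B `<=` A -> P B = 0%E \/ P B = P A].

Definition atomless : Prop := forall A, ~ atom A.

Definition same_law (Y Z : {RV P >-> R}) : Prop :=
  forall B, measurable B -> distribution P Y B = distribution P Z B.

(* Random variables are represented by measurable functions T -> R, with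
   equalities and inequalities between them read P-almost surely.  A space of
   (classes of) random variables is represented by the set of all members of
   its classes; closure under a.s. equality need not be required separately
   here, as it is an instance of law-invariance. *)
Record law_invariant_riesz_space (L : set (T -> R)) : Prop := {
  lirs_Linfty : forall Y, Y \in Lfun P +oo%E -> L Y;
  lirs_L1 : forall Y, L Y -> Y \in Lfun P 1%E;
  lirs_add : forall Y Z, L Y -> L Z -> L (Y \+ Z);
  lirs_scale : forall (a : R) Y, L Y -> L (a \*o Y);
  lirs_max : forall Y Z, L Y -> L Z -> L (Y \max Z);
  lirs_law : forall Y Z : {RV P >-> R}, L Y -> same_law Y Z -> L Z
}.

End ProbabilitySpace.

Section Utility.
Context {R : realType}.
Local Open Scope ereal_scope.

Definition upper_semicontinuous (f : R -> \bar R) : Prop :=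
  lower_semicontinuous (\- f).

Record utility_function (u : R -> \bar R) : Prop := {
  utility_ltpinfty : forall y, u y < +oo;
  utility_nondecreasing : {homo u : x y / (x <= y)%R >-> x <= y};
  utility_finite : forall c : R, (0 < c)%R -> -oo < u c;
  utility_lt_lim : forall z, u z < lim (u y @[y --> +oo%R]);
  utility_linear_growth : limf_esup (fun y : R => u y * (y^-1)%:E) +oo%R < +oo
}.

End Utility.

Section RiskFunctional.
Context {R : realType} {d : measure_display} {T : measurableType d}.
Variables (P : probability T R) (L : set (T -> R)).
Local Open Scope ereal_scope.

(* Only the values of rho on L matter.  Monotonicity for the a.s. order makes
   rho constant on classes of a.s. equal random variables. *)
Record risk_functional (rho : (T -> R) -> \bar R) : Prop := {
  risk_gtNinfty : forall Y, L Y -> -oo < rho Y;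
  risk_decreasing : forall Y Z, L Y -> L Z ->
    {ae P, forall x, (Y x <= Z x)%R} -> rho Z <= rho Y;
  risk_cst_fin : forall c : R, (0 < c)%R -> rho (cst c) \is a fin_num
}.

Definition cash_convex (rho : (T -> R) -> \bar R) : Prop :=
  forall (lambda : R) (Y : T -> R) (c : R),
    (0 < lambda)%R -> (lambda < 1)%R -> L Y ->
    rho (fun x => lambda * Y x + (1 - lambda) * c)%R
      <= lambda%:E * rho Y + (1 - lambda)%:E * rho (cst c).

Definition lower_Fatou (rho : (T -> R) -> \bar R) : Prop :=
  forall (Y_ : nat -> T -> R) (Y Z : T -> R),
    (forall n, L (Y_ n)) -> L Y -> L Z ->
    {ae P, forall x, Y_ n x @[n --> \oo] --> Y x} ->
    (forall n, {ae P, forall x, (`|Y_ n x| <= Z x)%R}) ->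
    rho Y <= limn_einf (fun n => rho (Y_ n)).

Definition expected_utility (u : R -> \bar R) (Y : T -> R) : \bar R :=
  \int[P]_x u (Y x).

End RiskFunctional.

Record market (R : realType) (T : Type) := Market {
  risky_assets : nat;
  rate : R;
  price0 : 'I_risky_assets.+1 -> R;
  price1 : 'I_risky_assets.+1 -> T -> R
}.

Section Market.
Context {R : realType} {d : measure_display} {T : measurableType d}.
Variables (P : probability T R) (L : set (T -> R)).
Implicit Type S : market R T.

Definition portfolio S := 'rV[R]_(risky_assets S).+1.

Definition initial_wealth S (theta : portfolio S) : R :=
  \sum_i theta ord0 i * price0 i.

Definition terminal_wealth S (theta : portfolio S) : T -> R :=
  fun x => \sum_i theta ord0 i * price1 i x.

Definition arbitrage S (theta : portfolio S) : Prop :=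
  [/\ initial_wealth theta <= 0,
      {ae P, forall x, (0 <= terminal_wealth theta x)%R} &
      (0 < P [set x | (0 < terminal_wealth theta x)%R])%E].

Definition arbitrage_free S : Prop :=
  ~ exists theta : portfolio S, arbitrage theta.

Definition nonredundant S : Prop :=
  forall theta : portfolio S,
    {ae P, forall x, terminal_wealth theta x = 0%R} -> theta = 0.

Record admissible_market S : Prop := {
  market_price0 : forall i, price0 (m := S) i = 1;
  market_rate : -1 < rate S;
  market_bond : {ae P, forall x, price1 (m := S) ord0 x = (1 + rate S)%R};
  market_payoffs : forall i, L (price1 (m := S) i);
  market_arbitrage_free : arbitrage_free S;
  market_nonredundant : nonredundant S
}.

Section PortfolioSelection.
Variables (util rho : (T -> R) -> \bar R).

Definition feasible S (w Rmax : R) (theta : portfolio S) : Prop :=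
  initial_wealth theta = w /\ (rho (terminal_wealth theta) <= Rmax%:E)%E.

Definition is_maximizer S (w Rmax : R) (theta : portfolio S) : Prop :=
  feasible w Rmax theta /\
  forall eta : portfolio S, feasible w Rmax eta ->
    (util (terminal_wealth eta) <= util (terminal_wealth theta))%E.

Definition well_posed S : Prop :=
  forall w Rmax : R, 0 < w ->
    (rho (cst (w * (1 + rate S))%R) <= Rmax%:E)%E ->
    exists theta : portfolio S, is_maximizer w Rmax theta.

Definition market_independent_well_posed : Prop :=
  forall S, admissible_market S -> well_posed S.

End PortfolioSelection.

End Market.

(* Main.v *)
Require Import Defs.
From mathcomp Require Import all_boot all_order all_algebra.
From mathcomp Require Import all_classical all_reals all_analysis.
From mathcomp Require Import measurable_realfun ess_sup_inf hoelder.

(** Portfolios of initial wealth w whose terminal wealth is a.s. nonnegative form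
    a compact set: a limit point of normalized portfolios of diverging norm
    would be a nonzero portfolio with zero cost and nonnegative payoff, against
    no-arbitrage and non-redundancy.  The risk constraint is closed by the Fatou
    property, since all these wealths are dominated by a fixed element of L.
    As u = -oo on (-oo, 0], every portfolio outside this set has utility -oo,
    whereas the bond has finite utility.  Linear growth of u gives an integrable
    majorant, so by the reverse Fatou lemma and upper semicontinuity of u the
    expected utility is upper semicontinuous, and a limit point of a maximizing
    sequence is a maximizer. *)

Set Implicit Arguments.
Unset Strict Implicit.
Unset Printing Implicit Defensive.

Import Order.TTheory GRing.Theory Num.Theory.
Import numFieldNormedType.Exports.

Local Open Scope classical_set_scope.
Local Open Scope ring_scope.

(** * Sequential compactness of bounded sets of row vectors *)

Lemma bounded_rV_cvg_subseq (R : realType) (n : nat) (x_ : nat -> 'rV[R]_n)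
    (M : R) :
  (forall k, `|x_ k| <= M) ->
  exists f : nat -> nat, (forall k, (k <= f k)%N) /\
    exists x : 'rV[R]_n, (fun k => x_ (f k)) @ \oo --> x.
Proof.
move=> xM.
have cK : compact [set y : 'rV[R]_n | `|y| <= M].
  apply: bounded_closed_compact.
    exists M; split; first exact: num_real.
    by move=> r Mr y /= /le_trans; apply; exact: ltW.
  apply: (@closed_comp _ _ (fun y : 'rV[R]_n => `|y|) [set r | r <= M]).
    by move=> y _; exact: norm_continuous.
  exact: closed_le.
have [|x [_ xcl]] := cK (x_ @ \oo) _ _; first by exists 0%N => // k _ /=.
(* The cluster point [x] meets every tail of the sequence, so an index [m] beyond [k] lies within
   [1/(k+1)] of it. The resulting reindexing dominates the identity but need not be monotone; this
   is enough for the limit and for the rates used later. *)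
have near_x k : {m | (k <= m)%N /\ `|x - x_ m| < k.+1%:R^-1}.
  apply: cid; have k0 : (0 < k.+1%:R^-1 :> R) by rewrite invr_gt0.
  have tail : (x_ @ \oo) (x_ @` [set m | (k <= m)%N]).
    by exists k => // m /= km; exists m.
  have [_ [[m km <-] xm]] := xcl _ _ tail (nbhsx_ballx x _ k0).
  by exists m; split => //; move: xm; rewrite -ball_normE.
exists (fun k => sval (near_x k)); split.
  by move=> k; case: (svalP (near_x k)).
exists x; apply/cvgrPdist_lt => e e0; near=> k.
have [_ /lt_trans->//] := svalP (near_x k).
by near: k; exact: near_infty_natSinv_lt (PosNum e0).
Unshelve. all: by end_near. Qed.

Lemma measurableT_oppe d (T : measurableType d) (R : realType) (f : T -> \bar R) :
  measurable_fun [set: T] f -> measurable_fun [set: T] (\- f)%E.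
Proof. by move=> mf; exact: measurableT_comp. Qed.

(** * Integrals of functions with an integrable majorant *)

Section DominatedAbove.
Context d (T : measurableType d) (R : realType).
Variable mu : {measure set T -> \bar R}.
Local Open Scope ereal_scope.

(** The positive part of [f] is controlled by that of [g]; an infinite integral of the negative part
    would then force the integral of [f] to be [-oo]. *)
Lemma le_integrable_gtNy (f g : T -> \bar R) :
  measurable_fun [set: T] f -> mu.-integrable [set: T] g ->
  (forall x, f x <= g x) -> -oo < \int[mu]_x f x ->
  mu.-integrable [set: T] f.
Proof.
move=> mf ig fg Nyf; apply/integrableP; split => //.
have fp : \int[mu]_x f^\+ x < +oo.
  apply: le_lt_trans (integrable_lty measurableT (integrable_funepos measurableT ig)).
  apply: ge0_le_integral => //.
  - exact: measurable_funepos.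
  - by apply: measurable_funepos; case/integrableP : ig.
  - by move=> x _; rewrite !funeposE ge_max !le_max lexx fg orbT.
have fn : \int[mu]_x f^\- x < +oo.
  rewrite ltey; apply/eqP => fny; move: Nyf; rewrite integralE fny /= addeNy ?ltxx//.
under eq_integral do rewrite -[`|f _|]/((abse \o f) _) fune_abse.
rewrite ge0_integralD//; first by rewrite lte_add_pinfty.
- exact: measurable_funepos.
- exact: measurable_funeneg.
Qed.

(** If the integral of [f] is [-oo], both sides are [+oo]: were [g - f] integrable, so would be
    [f = g - (g - f)]. Otherwise [f] is integrable and linearity applies. *)
Lemma integralB_dominated (f g : T -> \bar R) :
  measurable_fun [set: T] f -> mu.-integrable [set: T] g ->
  (forall x, g x \is a fin_num) -> (forall x, f x <= g x) ->
  \int[mu]_x (g x - f x) = \int[mu]_x g x - \int[mu]_x f x.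
Proof.
move=> mf ig gfin fg.
have [Nyf|] := ltP -oo (\int[mu]_x f x).
  by rewrite integralB//; exact: le_integrable_gtNy ig _ _.
rewrite leeNy_eq => /eqP fNy; rewrite fNy.
have mgf : measurable_fun [set: T] (fun x => g x - f x).
  by apply: emeasurable_funB => //; case/integrableP : ig.
have Gfin := integrable_fin_num measurableT ig.
rewrite /= addey; last by apply: contraTneq Gfin => ->.
apply/eqP; rewrite eq_le leey /= leNgt; apply/negP => gf_lt.
have igf : mu.-integrable [set: T] (fun x => g x - f x).
  apply/integrableP; split => //.
  rewrite (_ : \int[mu]_x _ = \int[mu]_x (g x - f x))//.
  by apply: eq_integral => x _; rewrite gee0_abs// sube_ge0 ?gfin ?orbT.
have : mu.-integrable [set: T] (fun x => g x - (g x - f x)) by exact: integrableB.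
have -> : (fun x => g x - (g x - f x)) = f.
  apply/funext => x; case: (g x) (f x) (gfin x) => // r [s| |] _ //=.
  by rewrite -!EFinB subKr.
by move=> /(integrable_fin_num measurableT); rewrite fNy.
Qed.

(** Fatou's lemma is applied to the nonnegative functions [g - f_ n], and the finite integral of [g]
    is cancelled. *)
Lemma reverse_fatou (f_ : nat -> T -> \bar R) (f g : T -> \bar R) :
  (forall n, measurable_fun [set: T] (f_ n)) -> measurable_fun [set: T] f ->
  mu.-integrable [set: T] g -> (forall x, g x \is a fin_num) ->
  (forall n x, f_ n x <= g x) -> (forall x, f x <= g x) ->
  (forall x, limn_esup (f_ ^~ x) <= f x) ->
  limn_esup (fun n => \int[mu]_x f_ n x) <= \int[mu]_x f x.
Proof.
move=> mf_ mf ig gfin f_g fg f_f.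
have mg : measurable_fun [set: T] g by case/integrableP : ig.
have Gfin := integrable_fin_num measurableT ig.
have h0 n x : [set: T] x -> 0 <= g x - f_ n x by rewrite sube_ge0 ?gfin ?orbT.
have := fatou mu measurableT (fun n => emeasurable_funB mg (mf_ n)) h0.
under [X in _ <= limn_einf X]eq_fun do rewrite integralB_dominated//.
rewrite (limn_einf_shift (fun n => - \int[mu]_x f_ n x) Gfin).
rewrite (limn_einfN (fun n => \int[mu]_x f_ n x)).
move=> le1; rewrite -leeN2 -(leeD2lE _ _ Gfin); apply: le_trans le1.
rewrite -integralB_dominated//; apply: ge0_le_integral => //.
- by move=> x _; rewrite sube_ge0 ?gfin ?orbT.
- exact: emeasurable_funB.
(* Measurability is known for upper limits; the lower limit is by definition the opposite of the
   upper limit of the opposites. *)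
- rewrite (_ : (fun x => _) = \- (fun x => limn_esup (fun n => - (g x - f_ n x)))).
    apply: measurableT_oppe; apply: measurable_fun_limn_esup => n.
    by apply: measurableT_oppe; exact: emeasurable_funB.
  by [].
move=> x _; rewrite (limn_einf_shift (fun n => - f_ n x) (gfin x)).
by rewrite (limn_einfN (f_ ^~ x)) leeD2l// leeN2.
Qed.

End DominatedAbove.

(** * Growth, measurability and sequential semicontinuity of [u] *)

Section Utility.
Context (R : realType) (u : R -> \bar R).
Hypothesis u_utility : utility_function u.
Local Open Scope ereal_scope.

(** Beyond some threshold the finite upper limit of [u y / y] gives a slope [b]; below it
    monotonicity bounds [u] by its value at the threshold. *)
Lemma utility_linear_bound :
  exists a b : R, (0 <= b)%R /\ forall y : R, u y <= (a + b * `|y|)%:E.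
Proof.
have /ereal_inf_lt[_ [V [M [_ MV]] <-]] := utility_linear_growth u_utility.
move=> supV.
have [b b0 bV] : exists2 b : R, (0 <= b)%R &
    forall y, (M < y)%R -> u y * (y^-1)%:E <= b%:E.
  have Vsup y : (M < y)%R -> u y * (y^-1)%:E <= ereal_sup [set u x * (x^-1)%:E | x in V].
    by move=> My; apply: ereal_sup_ubound; exists y => //; exact: MV.
  case: (ereal_sup _) supV Vsup => [s| |]// _ Vs.
    exists (Num.max 0%R s); first by rewrite le_max lexx.
    by move=> y /Vs /le_trans; apply; rewrite lee_fin le_max lexx orbT.
  by exists 0%R => // y /Vs /le_trans; apply; rewrite leNye.
(* The threshold must exceed [M], for the slope bound, and [0], for [u M1] to be finite. *)
pose M1 : R := (Num.max M 0 + 1)%R.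
have M1M : (M < M1)%R by rewrite ltr_pwDr// le_max lexx.
have M10 : (0 < M1)%R by rewrite ltr_pwDr// le_max lexx orbT.
have uM1 : u M1 \is a fin_num.
  by rewrite fin_numElt utility_finite// utility_ltpinfty.
exists (`|fine (u M1)|)%R, b; split => // y.
have [yM1|M1y] := leP y M1.
  apply: (le_trans (utility_nondecreasing u_utility yM1)).
  by rewrite -(fineK uM1) lee_fin (le_trans (ler_norm _))// lerDl mulr_ge0.
have y0 : (0 < y)%R by exact: lt_trans M1y.
have := bV _ (lt_trans M1M M1y).
rewrite -[_ * _ <= _](@lee_pmul2r _ y%:E) ?lte_fin//.
rewrite -muleA -!EFinM mulVf ?gt_eqF// mule1 => /le_trans; apply.
by rewrite lee_fin (gtr0_norm y0) lerDr.
Qed.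

Hypothesis u_usc : upper_semicontinuous u.

Lemma utility_measurable : measurable_fun [set: R] u.
Proof.
have -> : u = \- (\- u) by apply/funext => x; rewrite oppeK.
apply: measurableT_oppe.
exact: lower_semicontinuous_measurable.
Qed.

(** For each real [a] above [u y], [u] stays below [a] near [y], hence along a tail of the sequence;
    then [a] decreases to [u y], which may be [-oo]. *)
Lemma upper_semicontinuous_limn_esup (y_ : nat -> R) (y : R) :
  y_ @ \oo --> y -> limn_esup (u \o y_) <= u y.
Proof.
move=> yy.
have below a : u y < a%:E -> limn_esup (u \o y_) <= a%:E.
  rewrite -lteN2 -EFinN => /u_usc[V yV Vu].
  apply: (@le_trans _ _ (ereal_sup [set (u \o y_) n | n in y_ @^-1` V])).
    by apply: ereal_inf_lbound; exists (y_ @^-1` V) => //; exact: yy.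
  apply: ge_ereal_sup => _ [n /Vu + <-] /=.
  by rewrite EFinN lteN2 => /ltW.
case: (u y) below => [r| |] below; last 2 first.
- by rewrite leey.
- case: (limn_esup _) below => [s| |]// below; last by have := below 0%R (ltNyr _).
  by have := below (s - 1)%R (ltNyr _); rewrite lee_fin lerBrDr gerDl ler10.
apply/lee_addgt0Pr => e e0; rewrite -EFinD; apply: below.
by rewrite lte_fin ltrDl.
Qed.

End Utility.

(** * Wealth as a linear form in the portfolio *)

Section Market.
Context d (T : measurableType d) (R : realType).
Variable P : probability T R.
Implicit Type S : market R T.

Lemma terminal_wealthZ S (a : R) (theta : portfolio S) x :
  terminal_wealth (a *: theta) x = a * terminal_wealth theta x.
Proof.
by rewrite /terminal_wealth mulr_sumr; apply: eq_bigr => i _; rewrite mxE mulrA.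
Qed.

Lemma initial_wealthZ S (a : R) (theta : portfolio S) :
  initial_wealth (a *: theta) = a * initial_wealth theta.
Proof.
by rewrite /initial_wealth mulr_sumr; apply: eq_bigr => i _; rewrite mxE mulrA.
Qed.

Lemma cvg_linear_form (n : nat) (theta_ : nat -> 'rV[R]_n) (theta : 'rV[R]_n)
    (c : 'I_n -> R) :
  theta_ @ \oo --> theta ->
  (fun k => \sum_i theta_ k ord0 i * c i) @ \oo --> \sum_i theta ord0 i * c i.
Proof.
move=> cv; apply: cvg_big; first exact: add_continuous.
move=> i _; apply: cvgM; last exact: cvg_cst.
exact: (cvg_comp _ _ cv (@coord_continuous _ _ _ ord0 i theta)).
Qed.

Lemma cvg_terminal_wealth S (theta_ : nat -> portfolio S) (theta : portfolio S) x :
  theta_ @ \oo --> theta ->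
  (fun k => terminal_wealth (theta_ k) x) @ \oo --> terminal_wealth theta x.
Proof. exact: cvg_linear_form. Qed.

Lemma cvg_initial_wealth S (theta_ : nat -> portfolio S) (theta : portfolio S) :
  theta_ @ \oo --> theta ->
  (fun k => initial_wealth (theta_ k)) @ \oo --> initial_wealth theta.
Proof. exact: cvg_linear_form. Qed.

(** Up to the factor [|theta|], this dominates every terminal wealth. It supplies both the
    dominating variable of the Fatou property and the integrable majorant of the utilities. *)
Definition payoff_bound S (x : T) : R := \sum_i `|price1 (m := S) i x|.

Lemma terminal_wealth_bound S (theta : portfolio S) x :
  `|terminal_wealth theta x| <= `|theta| * payoff_bound S x.
Proof.
rewrite (le_trans (ler_norm_sum _ _ _))// mulr_sumr ler_sum// => i _.
rewrite normrM ler_wpM2r//.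
(* The norm of a row vector is the largest absolute value of its entries. *)
rewrite [leRHS]/Num.norm/= mx_normrE.
exact: (le_bigmax 0 (fun ij : 'I_1 * 'I__ => `|theta ij.1 ij.2|) (ord0, i)).
Qed.

(** * Membership of constants and wealths in [L] *)

Section RieszSpace.
Variables (L : set (T -> R)).
Hypothesis L_space : law_invariant_riesz_space P L.

Lemma Riesz_cst (c : R) : L (cst c).
Proof.
apply: (lirs_Linfty L_space); rewrite inE; apply/andP; split; rewrite inE/=.
  exact: measurable_cst.
have P0 : (0 < P setT)%E by rewrite probability_setT lte01.
by rewrite /finite_norm unlock/= P0 (ess_sup_cst `|c|%:E P0) ltry.
Qed.

Lemma Riesz_sum (I : finType) (Y : I -> T -> R) :
  (forall i, L (Y i)) -> L (fun x => \sum_i Y i x).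
Proof.
move=> LY; rewrite (_ : (fun x => _) = \sum_i Y i); last first.
  by apply/funext => x; rewrite fct_sumE.
apply: (big_ind (fun f => L f)) => //.
- exact: (Riesz_cst 0).
- exact: (lirs_add L_space).
Qed.

Lemma Riesz_norm (Y : T -> R) : L Y -> L (fun x => `|Y x|).
Proof.
move=> LY; rewrite (_ : (fun x => _) = Y \max (-1 \*o Y)).
  by apply: (lirs_max L_space) => //; exact: (lirs_scale L_space).
apply/funext => x /=; rewrite mulN1r; have [Y0|/ltW Y0] := leP 0 (Y x).
  by rewrite ger0_norm// max_l// ge0_cp.
by rewrite ler0_norm// max_r// le0_cp.
Qed.

Lemma Riesz_integrable (Y : T -> R) : L Y -> P.-integrable [set: T] (EFin \o Y).
Proof. by move=> LY; apply/Lfun1_integrable; exact: lirs_L1 LY. Qed.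

Variable S : market R T.
Hypothesis S_payoffs : forall i, L (price1 (m := S) i).

Lemma terminal_wealth_Riesz (theta : portfolio S) : L (terminal_wealth theta).
Proof. by apply: Riesz_sum => i; exact: (lirs_scale L_space). Qed.

Lemma payoff_bound_Riesz : L (@payoff_bound S).
Proof. by apply: Riesz_sum => i; exact: Riesz_norm. Qed.

End RieszSpace.
End Market.

(** * Boundedness of the portfolios with nonnegative payoff *)

Section NonnegativePortfolios.
Context d (T : measurableType d) (R : realType).
Variables (P : probability T R) (L : set (T -> R)) (S : market R T).
Hypotheses (L_space : law_invariant_riesz_space P L)
  (S_admissible : admissible_market P L S).
Implicit Types theta eta : portfolio S.

Let S_payoffs := market_payoffs S_admissible.

Lemma measurable_terminal_wealth theta :
  measurable_fun [set: T] (terminal_wealth theta).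
Proof.
have /(Riesz_integrable L_space) := terminal_wealth_Riesz L_space S_payoffs theta.
by case/integrableP => /measurable_EFinP.
Qed.

(** Countably many null sets are discarded together; the inequality then passes to the pointwise
    limit. *)
Lemma terminal_wealth_ge0_closed (theta_ : nat -> portfolio S) theta :
  theta_ @ \oo --> theta ->
  (forall n, {ae P, forall x, 0 <= terminal_wealth (theta_ n) x}) ->
  {ae P, forall x, 0 <= terminal_wealth theta x}.
Proof.
move=> cv /ae_foralln; apply: filterS => x tw0.
apply: (cvgr_to_ge (cvg_terminal_wealth cv)).
exact: nearW.
Qed.

(** Absence of arbitrage makes the payoff zero a.s., and non-redundancy then makes the portfolio
    zero. *)
Lemma costless_ge0_eq0 theta :
  initial_wealth theta = 0 -> {ae P, forall x, 0 <= terminal_wealth theta x} ->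
  theta = 0.
Proof.
move=> theta0 tw0; apply: (market_nonredundant S_admissible).
have mpos : measurable [set x | 0 < terminal_wealth theta x].
  have := measurable_terminal_wealth theta measurableT (measurable_itv `]0, +oo[).
  by rewrite setTI; congr measurable; apply/seteqP; split => x /=;
     rewrite in_itv/= andbT.
have pos0 : P.-negligible [set x | 0 < terminal_wealth theta x].
  apply/negligibleP => //; apply/eqP; rewrite -measure_le0 leNgt; apply/negP => pos.
  by apply: (market_arbitrage_free S_admissible); exists theta; split => //; rewrite theta0.
have npos : {ae P, forall x, terminal_wealth theta x <= 0}.
  apply: negligibleS pos0 => x /= /negP; rewrite -ltNge; exact.
near=> x; apply/eqP; rewrite eq_le; apply/andP; split; by near: x.
Unshelve. all: by end_near. Qed.

Lemma nonneg_portfolios_bounded (w : R) :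
  exists M : R, forall theta, initial_wealth theta = w ->
    {ae P, forall x, 0 <= terminal_wealth theta x} -> `|theta| <= M.
Proof.
apply/not_existsP => unbounded.
have large n : {theta : portfolio S | [/\ initial_wealth theta = w,
    {ae P, forall x, 0 <= terminal_wealth theta x} & n.+1%:R < `|theta|]}.
  apply: cid; have /existsNP[theta /not_implyP[thw /not_implyP[th0 /negP]]] :=
    unbounded n.+1%:R.
  by rewrite -ltNge => thn; exists theta.
pose theta_ n := sval (large n).
have norm_gt0 n : 0 < `|theta_ n|.
  by have [_ _] := svalP (large n); apply: lt_trans.
pose eta_ n := `|theta_ n|^-1 *: theta_ n.
have norm1 n : `|eta_ n| = 1.
  by rewrite /eta_ normrZ normfV normr_id mulVf ?gt_eqF.
have [|f [fn [eta cv]]] := @bounded_rV_cvg_subseq _ _ eta_ 1.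
  by move=> k; rewrite norm1.
have : `|eta| = 1.
  have : (fun k => `|eta_ (f k)|) @ \oo --> `|eta| by exact: cvg_norm cv.
  rewrite (_ : (fun k => _) = cst 1); last by apply/funext => k; exact: norm1.
  by move=> /cvg_unique; apply => //; exact: cvg_cst.
suff -> : eta = 0 by rewrite normr0 => /eqP; rewrite eq_sym oner_eq0.
apply: costless_ge0_eq0; last first.
  apply: (terminal_wealth_ge0_closed cv) => n.
  have [_ + _] := svalP (large (f n)); apply: filterS => x tw0.
  by rewrite terminal_wealthZ mulr_ge0// invr_ge0 normr_ge0.
(* The normalized portfolio costs [w / |theta_ (f n)|], at most [|w| / (n+1)] in absolute value
   since [f n >= n]; so the limit [eta] costs nothing. *)
apply/eqP; rewrite -normr_le0 -(mulr0 `|w|).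
apply: (ler_cvg_to (cvg_norm (cvg_initial_wealth cv))
  (cvgM (cvg_cst `|w|) cvg_harmonic)).
apply: nearW => n /=; have [iw _ large_n] := svalP (large (f n)).
rewrite /eta_ initial_wealthZ -/(theta_ _) [X in _ * X]iw normrM mulrC.
rewrite ler_wpM2l// normfV normr_id lef_pV2 ?posrE// (le_trans _ (ltW large_n))//.
by rewrite ler_nat ltnS.
Qed.

End NonnegativePortfolios.

(** * Existence of an optimal portfolio *)

Section PortfolioSelection.
Context d (T : measurableType d) (R : realType).
Variables (P : probability T R) (L : set (T -> R)) (u : R -> \bar R)
  (rho : (T -> R) -> \bar R) (S : market R T).
Hypotheses (L_space : law_invariant_riesz_space P L)
  (u_utility : utility_function u) (u_usc : upper_semicontinuous u)
  (u0 : u 0 = -oo%E)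
  (rho_risk : risk_functional P L rho) (rho_Fatou : lower_Fatou P L rho)
  (S_admissible : admissible_market P L S).
Implicit Types theta eta : portfolio S.

Let S_payoffs := market_payoffs S_admissible.
Let EU theta := expected_utility P u (terminal_wealth theta).

Lemma measurable_utility_wealth theta :
  measurable_fun [set: T] (fun x => u (terminal_wealth theta x)).
Proof.
apply: (measurableT_comp (utility_measurable u_usc)).
exact: measurable_terminal_wealth L_space S_admissible theta.
Qed.

(** The affine bound on [u] and the payoff bound combine into an element of [L] that depends on the
    portfolio only through the radius [M]. *)
Lemma utility_wealth_dominated : exists g : R -> T -> R, forall M,
  P.-integrable [set: T] (EFin \o g M) /\
  forall theta, `|theta| <= M ->
    forall x, (u (terminal_wealth theta x) <= (g M x)%:E)%E.
Proof.
have [a [b [b0 ub]]] := utility_linear_bound u_utility.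
exists (fun M x => a + b * (M * payoff_bound S x)) => M; split.
  apply: (Riesz_integrable L_space).
  apply: (lirs_add L_space (Riesz_cst L_space a)).
  do 2 apply: (lirs_scale L_space).
  exact: (payoff_bound_Riesz L_space).
move=> theta thM x; apply: (le_trans (ub _)); rewrite lee_fin lerD2l ler_wpM2l//.
apply: (le_trans (terminal_wealth_bound _ _)); rewrite ler_wpM2r//.
by apply: sumr_ge0.
Qed.

Lemma EU_gtNy_integrable theta : (-oo < EU theta)%E ->
  P.-integrable [set: T] (fun x => u (terminal_wealth theta x)).
Proof.
have [g gP] := utility_wealth_dominated; have [ig ug] := gP `|theta|.
apply: (le_integrable_gtNy _ ig); last exact: ug.
exact: measurable_utility_wealth.
Qed.

(** An integrable utility is finite a.s., whereas negative wealth gives utility at most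
    [u 0 = -oo]. *)
Lemma EU_gtNy_ge0 theta : (-oo < EU theta)%E ->
  {ae P, forall x, 0 <= terminal_wealth theta x}.
Proof.
move=> /EU_gtNy_integrable/(integrable_ae measurableT); apply: filterS => x.
move=> /(_ I) ufin; rewrite leNgt; apply/negP => /ltW.
move=> /(utility_nondecreasing u_utility); rewrite u0 leeNy_eq => /eqP uNy.
by rewrite uNy in ufin.
Qed.

Lemma bond_portfolio (w Rmax : R) : 0 < w ->
  (rho (cst (w * (1 + rate S))%R) <= Rmax%:E)%E ->
  exists theta, feasible rho w Rmax theta /\ (-oo < EU theta)%E.
Proof.
(* All wealth goes into asset [0], the bond, whose payoff [w (1 + r)] is positive and so has finite
   utility. *)
move=> w0 rho_le; pose theta : portfolio S := \row_j (w * (j == ord0)%:R).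
have sum_theta (c : 'I_(risky_assets S).+1 -> R) :
    \sum_i theta ord0 i * c i = w * c ord0.
  rewrite (bigD1 ord0)//= mxE eqxx mulr1 big1 ?addr0// => i /negbTE i0.
  by rewrite mxE i0 mulr0 mul0r.
have bond : {ae P, forall x, terminal_wealth theta x = w * (1 + rate S)}.
  apply: filterS (market_bond S_admissible) => x bx.
  by rewrite /terminal_wealth sum_theta bx.
have wr0 : 0 < w * (1 + rate S).
  by rewrite mulr_gt0// addrC -ltrBlDr sub0r (market_rate S_admissible).
exists theta; split; first split.
- by rewrite /initial_wealth sum_theta (market_price0 S_admissible) mulr1.
- apply: le_trans rho_le; apply: (risk_decreasing rho_risk).
  + exact: (Riesz_cst L_space).
  + exact: (terminal_wealth_Riesz L_space).
  + by apply: filterS bond => x ->.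
rewrite /EU /expected_utility.
rewrite (_ : integral _ _ _ = u (w * (1 + rate S))%R); first exact: utility_finite.
transitivity (\int[P]_x cst (u (w * (1 + rate S))%R) x)%E.
  apply: ae_eq_integral => //; first exact: measurable_utility_wealth.
  by apply: filterS bond => x -> _.
by rewrite integral_cst// [X in (_ * X)%E](probability_setT P) mule1.
Qed.

Lemma feasible_closed (w Rmax : R) (theta_ : nat -> portfolio S) theta :
  (forall n, feasible rho w Rmax (theta_ n)) -> theta_ @ \oo --> theta ->
  feasible rho w Rmax theta.
Proof.
move=> feas cv; split.
  apply: (cvg_unique _ (cvg_initial_wealth cv)) => //.
  rewrite (_ : (fun k => _) = cst w); first exact: cvg_cst.
  by apply/funext => k; case: (feas k).
(* Convergence bounds the norms only eventually; shifting by [N] gives the domination at every index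
   that the Fatou property asks for. *)
have [M thM] : exists M : R, \forall k \near \oo, `|theta_ k| <= M.
  exists (`|theta| + 1); near=> k.
  by apply/ltW; near: k; apply: (cvgr_lt _ (cvg_norm cv)); rewrite ltrDl.
case: thM => N _ thM.
have cvN : (fun k => theta_ (k + N)%N) @ \oo --> theta.
  by have := cv; rewrite -(cvg_shiftn N).
apply: (@le_trans _ _ (limn_einf (fun k => rho (terminal_wealth (theta_ (k + N)%N))))).
  apply: (rho_Fatou (Z := fun x => M * payoff_bound S x)).
  - by move=> k; exact: (terminal_wealth_Riesz L_space).
  - exact: (terminal_wealth_Riesz L_space).
  - by apply: (lirs_scale L_space); exact: (payoff_bound_Riesz L_space).
  - by apply: nearW => x; exact: (cvg_terminal_wealth cvN).
  - move=> k; apply: nearW => x; apply: (le_trans (terminal_wealth_bound _ _)).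
    by rewrite ler_wpM2r ?sumr_ge0//; apply: thM; rewrite /= leq_addl.
apply: (le_trans (limn_einf_sup _)).
apply: (@le_trans _ _ (ereal_sup [set rho (terminal_wealth (theta_ (k + N)%N)) | k in setT])).
  by apply: ereal_inf_lbound; exists setT => //; exact: filterT.
by apply: ge_ereal_sup => _ [k _ <-]; case: (feas (k + N)%N).
Unshelve. all: by end_near. Qed.

Lemma EU_upper_semicontinuous (theta_ : nat -> portfolio S) theta (M : R) :
  (forall n, `|theta_ n| <= M) -> theta_ @ \oo --> theta ->
  (limn_esup (EU \o theta_) <= EU theta)%E.
Proof.
move=> thM cv; have [g gP] := utility_wealth_dominated; have [ig ug] := gP M.
apply: (reverse_fatou _ _ ig) => //.
- by move=> n; exact: measurable_utility_wealth.
- exact: measurable_utility_wealth.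
- by move=> n x; exact: ug.
(* The limit lies in the same closed ball, so the same majorant serves. *)
- apply: ug; apply: (cvgr_to_le (cvg_norm cv)); exact: nearW.
- move=> x; apply: (upper_semicontinuous_limn_esup u_usc).
  exact: cvg_terminal_wealth.
Qed.

Lemma portfolio_selection_maximizer (w Rmax : R) : 0 < w ->
  (rho (cst (w * (1 + rate S))%R) <= Rmax%:E)%E ->
  exists theta, is_maximizer (expected_utility P u) rho w Rmax theta.
Proof.
move=> w0 rho_le; have [theta0 [feas0 EU0]] := bond_portfolio w0 rho_le.
have [M thM] := nonneg_portfolios_bounded L_space S_admissible w.
have {}thM theta : feasible rho w Rmax theta -> (-oo < EU theta)%E -> `|theta| <= M.
  by move=> [wth _] /EU_gtNy_ge0; exact: thM.
have [g gP] := utility_wealth_dominated; have [ig ug] := gP M.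
pose s := ereal_sup [set EU theta | theta in feasible rho w Rmax].
have EU_s theta : feasible rho w Rmax theta -> (EU theta <= s)%E.
  by move=> feas; apply: ereal_sup_ubound; exists theta.
(* The bond bounds [s] from below, the integral of [g M] from above. Finiteness makes [s - 1/(n+1)]
   a proper lower bound, so near-maximizers have utility above [-oo] and stay in the ball. *)
have sfin : s \is a fin_num.
  rewrite fin_numElt (lt_le_trans EU0 (EU_s _ feas0)) /=.
  apply: le_lt_trans (integrable_lty measurableT ig).
  apply: ge_ereal_sup => _ [theta feas <-].
  have [Nyth|] := ltP -oo%E (EU theta); last by rewrite leeNy_eq => /eqP ->; rewrite leNye.
  apply: le_integral => //; first exact: EU_gtNy_integrable.
  by move=> x _; apply: ug; exact: thM.
have near_s n : {theta | feasible rho w Rmax theta /\ (s - n.+1%:R^-1%:E < EU theta)%E}.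
  apply: cid; have n0 : 0 < n.+1%:R^-1 :> R by rewrite invr_gt0.
  by have [_ [theta feas <-]] := ub_ereal_sup_adherent n0 sfin; exists theta.
pose theta_ n := sval (near_s n).
have feas_ n : feasible rho w Rmax (theta_ n) by case: (svalP (near_s n)).
have s_theta n : (s - n.+1%:R^-1%:E < EU (theta_ n))%E by case: (svalP (near_s n)).
have theta_M n : `|theta_ n| <= M.
  by apply: thM => //; apply: le_lt_trans (s_theta n); exact: leNye.
have [f [fn [theta cv]]] := bounded_rV_cvg_subseq theta_M.
have EU_cvg : (fun k => EU (theta_ (f k))) @ \oo --> s.
  apply: (@squeeze_cvge _ _ _ _ (fun k => s - k.+1%:R^-1%:E)%E _ (cst s)).
  - apply: nearW => k /=; rewrite EU_s// andbT.
    apply: le_trans (ltW (s_theta (f k))); apply: leeD2l.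
    by rewrite lee_fin lerN2 lef_pV2 ?posrE// ler_nat ltnS.
  - rewrite -(fineK sfin) -[fine s in X in _ --> X]subr0.
    apply: cvg_EFin; first exact: nearW.
    by apply: cvgB; [exact: cvg_cst|exact: cvg_harmonic].
  - exact: cvg_cst.
exists theta; split; first exact: (feasible_closed (fun k => feas_ (f k)) cv).
(* The supremum [s] is the upper limit of the utilities along the subsequence, hence at most the
   utility of [theta]. *)
move=> eta /EU_s /le_trans; apply; rewrite -(cvg_limn_einf_sup EU_cvg).2.
exact: EU_upper_semicontinuous (fun k => theta_M (f k)) cv.
Qed.

End PortfolioSelection.

Theorem proposition6p2 (R : realType) (d : measure_display)
  (T : measurableType d) (P : probability T R) (L : set (T -> R))
  (u : R -> \bar R) (rho : (T -> R) -> \bar R)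
  (P_atomless : atomless P)
  (L_space : law_invariant_riesz_space P L)
  (u_utility : utility_function u)
  (u_usc : upper_semicontinuous u)
  (u0 : u 0%R = -oo%E)
  (rho_risk : risk_functional P L rho)
  (rho_cash_convex : cash_convex L rho)
  (rho_Fatou : lower_Fatou P L rho) :
  market_independent_well_posed P L (expected_utility P u) rho.
Proof.
move=> S S_admissible w Rmax w0 rho_le.
exact: (portfolio_selection_maximizer L_space u_utility u_usc u0 rho_risk
  rho_Fatou S_admissible w0 rho_le).
Qed.
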